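(* Let $d\ge1$, $k\ge d+3$, and let $[p]\in\mathfrak a_d^k$ be a splittable shape. Then $[p]$ is blurry. More precisely, there exists a shape $[q]\in\mathrm{Bl}([p])$ that is less degenerate than $[p]$, i.e. $C(q)\subsetneq C(p)$.
   Context: $\mathbb{RP}^d$ is the space of lines through the origin in $\mathbb R^{d+1}$. The group $\mathrm{PGL}(d):=\mathrm{GL}(d+1,\mathbb R)/\mathbb R^*$ acts component-wise on $A_d^k=(\mathbb{RP}^d)^k$, and $\mathfrak a_d^k=A_d^k/\mathrm{PGL}(d)$ carries the quotient topology; $[p]$ is the orbit (shape) of $p\in A_d^k$. For $I\subseteq\{1,\dots,k\}$, $\operatorname{rk}p_I$ is the dimension of the linear span in $\mathbb R^{d+1}$ of the lines $p_i$, $i\in I$, and $I^c=\{1,\dots,k\}\setminus I$. A configuration $p$ (and its shape $[p]$) is splittable if there is a non-empty subset $I\subsetneq\{1,\dots,k\}$ with $\operatorname{rk}p_I+\operatorname{rk}p_{I^c}\le d+1$. For $I\subseteq\{1,\dots,k\}$ and an integer $j$ with $1\le j<d+1$ and $|I|\ge j$, $p$ fulfills the projective subspace constraint $(I,j)$ if $\operatorname{rk}p_I\le j$. $C(p)$ is the set of all projective subspace constraints fulfilled by $p$; it depends only on $[p]$. The blur $\mathrm{Bl}(x)$ of a point $x$ in a topological space $M$ is the intersection of all open neighborhoods of $x$ in $M$; here $M=\mathfrak a_d^k$. The point $x$ is blurry if $\mathrm{Bl}(x)\supsetneq\{x\}$. *)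

(* Defs.v *)
From HB Require Import structures.
From mathcomp Require Import all_boot all_order all_algebra.
From mathcomp Require Import generic_quotient.
From mathcomp Require Import all_classical all_reals all_analysis.

Set Implicit Arguments.
Unset Strict Implicit.
Unset Printing Implicit Defensive.
Import Order.TTheory GRing.Theory Num.Theory.
Import numFieldNormedType.Exports.

Local Open Scope classical_set_scope.
Local Open Scope ring_scope.
Local Open Scope quotient_scope.

Section ProjectiveSpace.
Variables (R : realType) (d : nat).

(* [set_type] carries the subspace topology. *)
Definition nzvec : Type := set_type [set v : 'cV[R]_d.+1 | v != 0].
HB.instance Definition _ :=
  Topological.copy nzvec (set_type [set v : 'cV[R]_d.+1 | v != 0]).

Definition mk_nzvec (v : 'cV[R]_d.+1) (v0 : v != 0) : nzvec :=
  exist _ v (mem_set v0).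

Lemma nzvec_neq0 (v : nzvec) : val v != 0.
Proof. by case: v => v /= /set_mem. Qed.

Definition same_line (v w : nzvec) : bool :=
  `[< exists2 c : R, c != 0 & val w = c *: val v >].

Lemma same_lineP (v w : nzvec) :
  reflect (exists2 c : R, c != 0 & val w = c *: val v) (same_line v w).
Proof. exact: asboolP. Qed.

Lemma same_line_equiv : equiv_class_of same_line.
Proof.
split=> [v|v w|v u w].
- by apply/same_lineP; exists 1; rewrite ?oner_neq0 ?scale1r.
- by apply/same_lineP/same_lineP => -[c c0 E]; exists c^-1;
    rewrite ?invr_eq0 // E scalerA mulVf // scale1r.
- move=> /same_lineP[a a0 E] /same_lineP[b b0 F]; apply/same_lineP.
  by exists (b * a); rewrite ?mulf_neq0 // F E scalerA.
Qed.

Canonical same_line_eqrel := EquivRelPack same_line_equiv.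

Definition RP : Type := quotient_topology {eq_quot same_line_eqrel}.
HB.instance Definition _ := Topological.copy RP
  (quotient_topology {eq_quot same_line_eqrel}).
HB.instance Definition _ := Quotient.copy RP
  (quotient_topology {eq_quot same_line_eqrel}).

Lemma eqRP (v w : nzvec) : \pi_RP v = \pi_RP w <-> same_line v w.
Proof.
split; last by move=> vw; apply/(@eqquotP _ same_line_eqrel).
by move/(@eqquotP _ same_line_eqrel).
Qed.

Definition line (x : RP) : {vspace 'cV[R]_d.+1} := <[val (repr x)]>%VS.

Lemma line_pi (v : nzvec) : line (\pi_RP v) = <[val v]>%VS.
Proof.
have /eqRP/same_lineP[c c0 E] : \pi_RP (repr (\pi_RP v)) = \pi_RP v.
  by rewrite reprK.
apply/eqP; rewrite /line E eqEsubv -!memvE memvZ ?memv_line // andbT.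
by rewrite -[X in X \in _](scalerK c0) memvZ // memv_line.
Qed.

Definition GL : Type := {A : 'M[R]_d.+1 | A \in unitmx}.
HB.instance Definition _ := Choice.copy GL {A : 'M[R]_d.+1 | A \in unitmx}.

Definition mk_GL (A : 'M[R]_d.+1) (uA : A \in unitmx) : GL := exist _ A uA.

Definition homothetic (A B : GL) : bool :=
  `[< exists2 c : R, c != 0 & val B = c *: val A >].

Lemma homotheticP (A B : GL) :
  reflect (exists2 c : R, c != 0 & val B = c *: val A) (homothetic A B).
Proof. exact: asboolP. Qed.

Lemma homothetic_equiv : equiv_class_of homothetic.
Proof.
split=> [v|v w|v u w].
- by apply/homotheticP; exists 1; rewrite ?oner_neq0 ?scale1r.
- by apply/homotheticP/homotheticP => -[c c0 E]; exists c^-1;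
    rewrite ?invr_eq0 // E scalerA mulVf // scale1r.
- move=> /homotheticP[a a0 E] /homotheticP[b b0 F]; apply/homotheticP.
  by exists (b * a); rewrite ?mulf_neq0 // F E scalerA.
Qed.

Canonical homothetic_eqrel := EquivRelPack homothetic_equiv.

Definition PGL : Type := {eq_quot homothetic_eqrel}.
HB.instance Definition _ := Quotient.copy PGL {eq_quot homothetic_eqrel}.

Lemma GL_act_subproof (A : GL) (v : nzvec) : val A *m val v != 0.
Proof.
apply/eqP => E; move: (nzvec_neq0 v).
by rewrite -[val v](mulKmx (valP A)) E mulmx0 eqxx.
Qed.

Definition GL_act (A : GL) (v : nzvec) : nzvec :=
  mk_nzvec (GL_act_subproof A v).

(* Independent of the chosen representatives by [PGL_act_pi]. *)
Definition PGL_act (g : PGL) (x : RP) : RP := \pi_RP (GL_act (repr g) (repr x)).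

Lemma PGL_act_pi (A : GL) (v : nzvec) :
  PGL_act (\pi_PGL A) (\pi_RP v) = \pi_RP (GL_act A v).
Proof.
have /eqRP/same_lineP[c c0 E] : \pi_RP (repr (\pi_RP v)) = \pi_RP v.
  by rewrite reprK.
have /(@eqquotP _ homothetic_eqrel)/homotheticP[b b0 F] :
    \pi_PGL (repr (\pi_PGL A)) = \pi_PGL A by rewrite reprK.
apply/eqRP/same_lineP; exists (b * c); first exact: mulf_neq0.
by rewrite /= F E -scalemxAl -scalemxAr scalerA.
Qed.

Lemma PGL_act_repr (g : PGL) (v : nzvec) :
  PGL_act g (\pi_RP v) = \pi_RP (GL_act (repr g) v).
Proof. by rewrite -{1}[g]reprK PGL_act_pi. Qed.

End ProjectiveSpace.

Section Shapes.
Variables (R : realType) (d k : nat).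

(* [ptws] is the product topology. *)
Definition config : Type := {ptws 'I_k -> RP R d}.
HB.instance Definition _ := Topological.copy config {ptws 'I_k -> RP R d}.

Definition config_act (g : PGL R d) (p : config) : config :=
  fun i => PGL_act g (p i).

Definition same_orbit (p q : config) : bool :=
  `[< exists g : PGL R d, q = config_act g p >].

Lemma same_orbitP (p q : config) :
  reflect (exists g : PGL R d, q = config_act g p) (same_orbit p q).
Proof. exact: asboolP. Qed.

Lemma same_orbit_equiv : equiv_class_of same_orbit.
Proof.
have refl : reflexive same_orbit.
  move=> p; apply/same_orbitP; exists (\pi_(PGL R d) (mk_GL (unitmx1 _ _))).
  apply/funext => i; rewrite /config_act -[p i]reprK PGL_act_pi.
  by congr (\pi_(RP R d) _); apply: val_inj; rewrite /= mul1mx.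
have sym p q : same_orbit p q -> same_orbit q p.
  move=> /same_orbitP[g ->]; apply/same_orbitP.
  have iU : invmx (val (repr g)) \in unitmx by rewrite unitmx_inv (valP (repr g)).
  exists (\pi_(PGL R d) (mk_GL iU)).
  apply/funext => i; rewrite /config_act {2}/PGL_act PGL_act_pi -[LHS]reprK.
  by congr (\pi_(RP R d) _); apply: val_inj; rewrite /= mulKmx // (valP (repr g)).
split=> //.
- by move=> p q; apply/idP/idP; exact: sym.
- move=> q p r /same_orbitP[g ->] /same_orbitP[h ->]; apply/same_orbitP.
  have U : val (repr h) *m val (repr g) \in unitmx.
    by rewrite unitmx_mul (valP (repr h)) (valP (repr g)).
  exists (\pi_(PGL R d) (mk_GL U)).
  apply/funext => i; rewrite /config_act {2}/PGL_act PGL_act_repr.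
  rewrite -[p i in RHS]reprK PGL_act_pi.
  by congr (\pi_(RP R d) _); apply: val_inj; rewrite /= mulmxA.
Qed.

Canonical same_orbit_eqrel := EquivRelPack same_orbit_equiv.

Definition shape_space : Type := quotient_topology {eq_quot same_orbit_eqrel}.
HB.instance Definition _ := Topological.copy shape_space
  (quotient_topology {eq_quot same_orbit_eqrel}).
HB.instance Definition _ := Quotient.copy shape_space
  (quotient_topology {eq_quot same_orbit_eqrel}).

Definition shape_of (p : config) : shape_space := \pi_shape_space p.

Definition rk (p : config) (I : {set 'I_k}) : nat :=
  \dim (\sum_(i in I) line (p i))%VS.

Definition splittable (p : config) : Prop :=
  exists I : {set 'I_k},
    [/\ I != finset.set0, I \proper [set: 'I_k]%SET
      & (rk p I + rk p (~: I)%SET <= d.+1)%N].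

(* The constraint (I, j) is encoded as the pair c with c.1 = I, c.2 = j. *)
Definition constraints (p : config) : set ({set 'I_k} * nat) :=
  [set c : {set 'I_k} * nat | [/\ (1 <= c.2 < d.+1)%N, (c.2 <= #|c.1|)%N & (rk p c.1 <= c.2)%N]].

End Shapes.

Definition blur (M : topologicalType) (x : M) : set M :=
  \bigcap_(U in open_nbhs x) U.

Definition blurry (M : topologicalType) (x : M) : Prop :=
  [set x] `<` blur x.

(* Main.v *)
Require Import Defs.
From mathcomp Require Import all_boot all_order all_algebra.
From mathcomp Require Import generic_quotient.
From mathcomp Require Import all_classical all_reals all_analysis.

(* The blur of [p] contains [q] as soon as p is a limit of configurations in the
   orbit of q.  A splitting yields a decomposition R^(d+1) = V + W into
   complementary subspaces with W nonzero, and I such that the p_i, i in I, span V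
   and the others lie in W: if p spans R^(d+1) the spans of p_I and p_{I^c} are
   complementary; otherwise take I everything and W any complement.  Since
   k > d+1, up to exchanging I and I^c, some v = p_i, i in I, lies in the span of
   the other p_j, j in I.  Replace it by v + w with w nonzero in W: no rank drops
   and the rank of p_I increases.  Dilating W by t turns v + w into v + t w and
   fixes the other p_j, and t -> 0 recovers p. *)

Set Implicit Arguments.
Unset Strict Implicit.
Unset Printing Implicit Defensive.
Import Order.TTheory GRing.Theory Num.Theory.
Import numFieldNormedType.Exports.

Local Open Scope classical_set_scope.
Local Open Scope ring_scope.
Local Open Scope quotient_scope.

(** * Linear dependence and dilations along a direct sum *)

Section LinearAlgebra.
Variables (K : fieldType) (vT : vectType K).

Lemma dimv_addv_line (U : {vspace vT}) (x : vT) :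
  \dim (U + <[x]>) = (\dim U + (x \notin U))%N.
Proof.
have [xU|xU] := boolP (x \in U); first by rewrite addn0 (addv_idPl _).
rewrite dimv_disjoint_sum.
  by rewrite dim_vline; case: eqP xU => // ->; rewrite mem0v.
apply/eqP; rewrite -subv0; apply/subvP => y /memv_capP[yU /vlineP[c yE]].
have [c0|c0] := eqVneq c 0; first by rewrite yE c0 scale0r mem0v.
by case/negP: xU; rewrite -[x](scalerK c0) -yE memvZ.
Qed.

(** Induction on the size of [I]: if [v i] lies outside the span of the others, removing [i] lowers
    both the dimension and the cardinality by one, so the remaining family still satisfies the
    strict inequality. *)
Lemma mem_span_others (T : finType) (v : T -> vT) (I : {set T}) :
  (\dim (\sum_(i in I) <[v i]>)%VS < #|I|)%N ->
  exists2 i, i \in I & v i \in (\sum_(j in (I :\ i)%SET) <[v j]>)%VS.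
Proof.
have [n] := ubnP #|I|; elim: n I => // n IHn I ltIn dimI.
have /card_gt0P[i iI] : (0 < #|I|)%N by apply: leq_ltn_trans dimI.
have [vi|vi] := boolP (v i \in \sum_(j in (I :\ i)%SET) <[v j]>)%VS.
  by exists i.
move: dimI; rewrite (big_setD1 i) //= addvC dimv_addv_line vi (cardsD1 i) iI.
rewrite addn1 add1n ltnS => dimI.
have [|i' /setD1P[i'i i'I] vi'] := IHn _ _ dimI.
  by move: ltIn; rewrite (cardsD1 i) iI.
exists i' => //; move: vi'; apply: subvP; apply/subv_sumP => j.
rewrite !inE => /andP[ji' /andP[_ jI]].
by apply: (sumv_sup j); rewrite // !inE ji'.
Qed.

End LinearAlgebra.

(** With [P] and [Q] the projections onto V along W and onto W along V, the matrix is [P + t *: Q],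
    with inverse [P + t^-1 *: Q]. *)
Lemma exists_dilation (K : fieldType) (n : nat) (V W : {vspace 'cV[K]_n})
    (VW0 : (V :&: W = 0)%VS) (VWT : (V + W)%VS = fullv) (t : K) (t0 : t != 0) :
  exists2 A : 'M[K]_n, A \in unitmx
    & (forall x, x \in V -> A *m x = x) /\ (forall x, x \in W -> A *m x = t *: x).
Proof.
(* The transposes are there because [lin1_mx] represents maps acting on row vectors. *)
pose P : 'M[K]_n := (lin1_mx (trmx \o daddv_pi V W \o trmx))^T.
pose Q : 'M[K]_n := (lin1_mx (trmx \o daddv_pi W V \o trmx))^T.
have PE x : P *m x = daddv_pi V W x.
  by rewrite -[x in LHS]trmxK -trmx_mul mul_rV_lin1 /= !trmxK.
have QE x : Q *m x = daddv_pi W V x.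
  by rewrite -[x in LHS]trmxK -trmx_mul mul_rV_lin1 /= !trmxK.
have WV0 : (W :&: V = 0)%VS by rewrite capvC.
have PQ (x : 'cV[K]_n) : P *m x + Q *m x = x.
  by rewrite PE QE daddv_pi_add // VWT memvf.
have AV s (x : 'cV[K]_n) : x \in V -> (P + s *: Q) *m x = x.
  move=> xV; have Px : P *m x = x by rewrite PE daddv_pi_id.
  move: (PQ x); rewrite Px mulmxDl -scalemxAl Px => /(canRL (addKr _)) ->.
  by rewrite addNr scaler0 addr0.
have AW s (x : 'cV[K]_n) : x \in W -> (P + s *: Q) *m x = s *: x.
  move=> xW; have Qx : Q *m x = x by rewrite QE daddv_pi_id.
  move: (PQ x); rewrite Qx mulmxDl -scalemxAl Qx => /(canRL (addrK _)) ->.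
  by rewrite subrr add0r.
exists (P + t *: Q); last by split=> x; [exact: AV|exact: AW].
suff AB : (P + t *: Q) *m (P + t^-1 *: Q) = 1%:M by case: (mulmx1_unit AB).
set M := LHS; suff ME (x : 'cV[K]_n) : M *m x = x.
  apply/matrixP => i j; have /matrixP/(_ i 0) := ME (delta_mx j 0).
  by rewrite -colE [LHS]mxE [in RHS]mxE andbT => ->; rewrite mxE.
have PV : P *m x \in V by rewrite PE memv_pi.
have QW : Q *m x \in W by rewrite QE memv_pi.
rewrite -mulmxA -[in LHS](PQ x) mulmxDr (AV _ _ PV) (AW _ _ QW).
by rewrite mulmxDr (AV _ _ PV) -scalemxAr (AW _ _ QW) scalerA mulVf // scale1r.
Qed.

(** * Blurs and ranks of shapes *)

Section Shapes.
Variables (R : realType) (d k : nat).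
Implicit Types (p q : config R d k) (I J : {set 'I_k}).

Lemma same_orbit_rk p q I : same_orbit p q -> rk q I = rk p I.
Proof.
move=> /same_orbitP[g ->]; pose A := val (repr g).
have lineE i : line (config_act g p i) = (linfun (mulmx A) @: line (p i))%VS.
  by rewrite /config_act /PGL_act line_pi /= limg_line lfunE.
rewrite /rk (eq_bigr _ (fun i _ => lineE i)) -limg_sum limg_dim_eq //.
apply/eqP; rewrite -subv0; apply/subvP => x /memv_capP[_].
rewrite memv_ker lfunE /= => /eqP Ax0.
by rewrite -[x](mulKmx (valP (repr g))) [val _ *m x]Ax0 mulmx0 mem0v.
Qed.

(** An open neighborhood of the shape of [p] pulls back to a neighborhood of [p], which contains
    [F t] for some nonzero [t], and the shape of [F t] is that of [q]. *)
Lemma blur_shape p q (F : R -> config R d k) :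
  F t @[t --> 0] --> p -> (forall t : R, t != 0 -> same_orbit (F t) q) ->
  blur (shape_of p) (shape_of q).
Proof.
move=> Fp Fq U [oU Up].
have /Fp : nbhs p (@shape_of R d k @^-1` U).
  by apply: open_nbhs_nbhs; split => //; exact: oU.
rewrite nbhs_simpl /= => /nbhs_dnbhs FU.
have [t [/= FtU t0]] := filter_ex (filterI FU (@nbhs_dnbhs_neq R 0)).
suff <- : shape_of (F t) = shape_of q by [].
by apply/(@eqquotP _ (same_orbit_eqrel R d k)); exact: Fq.
Qed.

Lemma continuous_line (v w : 'cV[R]_d.+1) (vw0 : forall t, v + t *: w != 0) :
  continuous (fun t => \pi_(RP R d) (mk_nzvec (vw0 t))).
Proof.
have cont : continuous (fun t => mk_nzvec (vw0 t)).
  apply: (@continuous_comp_initial _ _ _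
            (@set_val _ [set v : 'cV[R]_d.+1 | v != 0])).
  move=> t; apply: cvgD; first exact: cvg_cst.
  exact: scalel_continuous.
move=> t; apply: (continuous_comp (cont t)); exact: pi_continuous.
Qed.

Lemma cvg_dfwith (i : 'I_k) p (x : R -> RP R d) :
  x t @[t --> 0] --> p i -> dfwith p i (x t) @[t --> 0] --> p.
Proof.
move=> xp; have := @dfwith_continuous 'I_k (fun=> RP R d) p i (p i).
rewrite /continuous_at.
have -> : dfwith p i (p i) = p by apply/funext => j; case: dfwithP.
exact: cvg_comp.
Qed.

Lemma rk_dfwith p i x J :
  rk (dfwith p i x) J
  = if i \in J then \dim (\sum_(j in (J :\ i)%SET) line (p j) + line x)%VS
    else rk p J.
Proof.
case: ifPn => iJ; rewrite /rk.
  rewrite (big_setD1 i) //= dfwithin addvC; congr (\dim (_ + _)%VS).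
  by apply: eq_bigr => j /setD1P[ji _]; rewrite dfwithout // eq_sym.
congr (\dim _); apply: eq_bigr => j jJ; rewrite dfwithout //.
by apply: contraNneq iJ => ->.
Qed.

(** Serves the spanning and the non-spanning case alike: all that matters about [W] is that it is a
    nonzero complement of V containing the lines outside [I]. *)
Lemma exists_less_degenerate p I (V := (\sum_(i in I) line (p i))%VS)
    (W : {vspace 'cV[R]_d.+1}) :
  (V :&: W = 0)%VS -> (V + W)%VS = fullv -> W != 0%VS ->
  (forall i, i \notin I -> (line (p i) <= W)%VS) -> (rk p I < #|I|)%N ->
  exists q, blur (shape_of p) (shape_of q) /\ constraints q `<` constraints p.
Proof.
move=> VW0 VWT W0 pW dimI.
have [i iI vi] := mem_span_others dimI.
set v := val (repr (p i)) in vi.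
pose w := vpick W.
have wW : w \in W by exact: memv_pick.
have w0 : w != 0 by rewrite vpick0.
have pV j : j \in I -> val (repr (p j)) \in V.
  by move=> jI; rewrite memvE; apply: (sumv_sup j).
have vV : v \in V by exact: pV.
have VWd x y : x \in V -> y \in W -> x = y -> x = 0.
  by move=> xV yW xy; apply/eqP; rewrite -memv0 -VW0 memv_cap xV xy.
have vw0 (t : R) : v + t *: w != 0.
  apply/eqP => /(canRL (addrK _)); rewrite sub0r => vE.
  have := nzvec_neq0 (repr (p i)); rewrite -/v (VWd _ _ vV _ vE) ?eqxx //.
  by rewrite memvN memvZ.
pose F (t : R) : config R d k := dfwith p i (\pi_(RP R d) (mk_nzvec (vw0 t))).
have FE J (t : R) (iJ : i \in J) :
    rk (F t) J = \dim (\sum_(j in (J :\ i)%SET) line (p j) + <[v + t *: w]>)%VS.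
  by rewrite rk_dfwith iJ line_pi.
exists (F 1%R); split.
  apply: (@blur_shape _ _ F) => [|t t0].
    apply: cvg_dfwith.
    suff -> : p i = \pi_(RP R d) (mk_nzvec (vw0 0)) by exact: continuous_line.
    rewrite -[LHS]reprK; congr (\pi_(RP R d) _).
    by apply: val_inj; rewrite /= scale0r addr0.
  (* Dilating by [t^-1] sends [v + t *: w] to [v + w], hence [F t] to [F 1]. *)
  have [A uA [AV AW]] := exists_dilation VW0 VWT (invr_neq0 t0).
  apply/same_orbitP; exists (\pi_(PGL R d) (mk_GL uA)); apply/funext => j.
  rewrite /config_act /F; case: dfwithP => [|j' ij'].
    rewrite dfwithin PGL_act_pi; congr (\pi_(RP R d) _); apply: val_inj => /=.
    by rewrite mulmxDr AV // -scalemxAr AW // scalerA mulfV.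
  rewrite dfwithout // -[p j']reprK PGL_act_pi; apply/eqRP/same_lineP => /=.
  have [jI|jI] := boolP (j' \in I).
    by exists 1; rewrite ?oner_neq0 // scale1r AV // pV.
  exists t^-1; first exact: invr_neq0.
  by rewrite AW // memvE; apply: pW.
have le_rk J : (rk p J <= rk (F 1%R) J)%N.
  have [iJ|iJ] := boolP (i \in J); last by rewrite rk_dfwith (negPf iJ).
  rewrite FE // scale1r /rk (big_setD1 i) //= addvC !dimv_addv_line leq_add2l.
  rewrite -/v; set S := (\sum_(j in _) _)%VS.
  (* Each rank is the dimension of [S], plus one exactly when the added vector is outside [S]. *)
  suff : v + w \in S -> v \in S.
    by case: (v \in S) => //; case: (v + w \in S) => // ->.
  (* Write [v + w = a + b] with [a] from the lines indexed in [I] and [b] from the others. Then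
     [v - a = b - w] lies in both V and W, so [v = a] is in [S]. *)
  rewrite {1}/S (bigID (mem I)) /= => /memv_addP[a aI [b bI vwab]].
  have aV : a \in V.
    apply: subvP aI; apply/subv_sumP => j /andP[_ jI].
    exact: (sumv_sup j).
  have bW : b \in W.
    by apply: subvP bI; apply/subv_sumP => j /andP[_]; exact: pW.
  have va : v - a = 0.
    apply: (VWd _ (b - w)); rewrite ?memvB //.
    by apply/eqP; rewrite subr_eq addrAC eq_sym subr_eq addrC eq_sym vwab addrC.
  rewrite (subr0_eq va); apply: subvP aI; apply/subv_sumP => j /andP[jJ _].
  exact: (sumv_sup j).
have lt_rk : (rk p I < rk (F 1%R) I)%N.
  rewrite FE // scale1r /rk (big_setD1 i) //= addvC !dimv_addv_line ltn_add2l.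
  (* The vector [v] adds nothing to the span of the others, while [v + w] is not even in V:
     otherwise [w] would lie in both V and W. *)
  rewrite vi /= lt0b; apply/negP => vwI.
  have vwV : v + w \in V.
    by apply: subvP vwI; apply/subv_sumP => j /setD1P[_ jI]; exact: (sumv_sup j).
  move: w0; rewrite (VWd w w) ?eqxx //.
  by rewrite -[w](addKr v) memvD // memvN.
(* The constraint [(I, rk p I)] separates the two: it holds for [p] and fails for [F 1]. It is
   admissible since V contains the nonzero [v] and its complement [W] is nonzero. *)
split=> [[J j] /= [j1 jJ rJ]|/(_ (I, rk p I)) /=].
  by split=> //; exact: leq_trans (le_rk J) rJ.
case=> [|_ _]; last by rewrite leqNgt lt_rk.
have dVW : (rk p I + \dim W)%N = d.+1.
  by rewrite -(dimv_disjoint_sum VW0) VWT dimvf /dim /= muln1.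
have dW : (0 < \dim W)%N by rewrite lt0n dimv_eq0.
split=> //; last exact: ltnW.
apply/andP; split; last by rewrite -dVW -addn1 leq_add2l.
by rewrite lt0n dimv_eq0 -subv0; apply: contra (nzvec_neq0 (repr (p i))) => V0;
  rewrite -memv0; apply: subvP V0 _ vV.
Qed.

Lemma splittable_less_degenerate p : (d.+1 < k)%N -> splittable p ->
  exists q, blur (shape_of p) (shape_of q) /\ constraints q `<` constraints p.
Proof.
move=> dk [I [I0 IT rkI]].
pose S J := (\sum_(i in J) line (p i))%VS.
have lineS J i : i \in J -> (line (p i) <= S J)%VS.
  by move=> iJ; apply: (sumv_sup i).
have S0 J : J != finset.set0 -> S J != 0%VS.
  case/set0Pn => i iJ; apply: contra (nzvec_neq0 (repr (p i))) => /eqP SJ0.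
  by rewrite -memv0 -SJ0 memvE; apply: lineS.
have STE : S finset.setT = (S I + S (~: I)%SET)%VS.
  rewrite /S (bigID (mem I)) /=; congr (_ + _)%VS; apply: eq_bigl => i.
    by rewrite inE.
  by rewrite !inE.
have fullE : \dim {: 'cV[R]_d.+1} = d.+1 by rewrite dimvf /dim /= muln1.
have [ST|ST] := eqVneq (S finset.setT) fullv; last first.
  apply: (@exists_less_degenerate p finset.setT (S finset.setT)^C%VS).
  - exact: capv_compl.
  - exact: addv_complf.
  - apply: contraNneq ST => SC0.
    by rewrite -(addv_complf (S finset.setT)) SC0 addv0.
  - by move=> i; rewrite inE.
  - rewrite cardsT card_ord; apply: leq_ltn_trans dk.
    by rewrite -fullE dimvS // subvf.
(* The sum has dimension d+1 and the two ranks add up to at most d+1, which leaves nothing for the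
   intersection. *)
have SI0 : (S I :&: S (~: I)%SET = 0)%VS.
  apply/eqP; rewrite -dimv_eq0 -leqn0 -(leq_add2l d.+1) addn0.
  by rewrite -{1}fullE -ST STE dimv_sum_cap.
have CI0 : (~: I)%SET != finset.set0.
  apply: contraTneq IT => CI0; rewrite -(finset.setCK I) CI0 finset.setC0.
  by rewrite fintype.properxx.
have [dI|dI] := ltnP (rk p I) #|I|.
  apply: (@exists_less_degenerate p I (S (~: I)%SET)) => //.
  - by rewrite -STE.
  - exact: S0.
  - by move=> i iI; apply: lineS; rewrite inE.
apply: (@exists_less_degenerate p (~: I)%SET (S I)) => //.
- by rewrite capvC.
- by rewrite addvC -STE.
- exact: S0.
- by move=> i; rewrite inE negbK; apply: lineS.
(* If both families were independent, their sizes, which add up to k, would be bounded by ranks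
   adding up to at most d+1. *)
- rewrite ltnNge; apply/negP => dC.
  move: dk; rewrite ltnNge => /negP; apply.
  rewrite -[X in (X <= _)%N](card_ord k) -(cardsC I).
  by apply: leq_trans rkI; apply: leq_add.
Qed.

End Shapes.

Theorem proposition5p3 (R : realType) (d k : nat) (d1 : (1 <= d)%N)
    (dk : (d + 3 <= k)%N) (p : config R d k) (sp : splittable p) :
  blurry (shape_of p) /\
  exists q : config R d k,
    blur (shape_of p) (shape_of q) /\ constraints q `<` constraints p.
Proof.
have dk' : (d.+1 < k)%N.
  by apply: leq_trans dk; rewrite -addn2 leq_add2l.
have [q [pq Cqp]] := splittable_less_degenerate dk' sp.
split; last by exists q.
(* If the blur were a single point, [q] would lie in the orbit of [p]; equal ranks would then give
   equal constraint sets, against strictness. *)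
split=> [_ -> U [_ //]|/(_ _ pq)/(@eqquotP _ (same_orbit_eqrel R d k)) qp].
case: Cqp => _; apply => -[I j] /= [? ? rI]; split=> //.
by rewrite -(same_orbit_rk _ qp).
Qed.
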